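(* There exists a subsequence $\omega$ of $p_0,p_1,p_2,\dots$ such that $\log N\ll r_N(\omega)\ll\log N$ for $N$ sufficiently large; i.e. there are constants $C_1,C_2>0$ and $N_1$ with $C_1\log N\le r_N(\omega)\le C_2\log N$ for all $N\ge N_1$.
   Context: Let $q=p^s$ be a prime power and $\mathbb{F}_q$ the field with $q$ elements. Fix a bijection $\iota:\{0,1,\dots,q-1\}\to\mathbb{F}_q$ with $\iota(0)=0$. For $N\in\mathbb{Z}_{\ge0}$ with base-$q$ expansion $N=c_0+c_1q+\dots+c_nq^n$ ($0\le c_i<q$), put $p_N=\iota(c_0)+\iota(c_1)T+\dots+\iota(c_n)T^n\in\mathbb{F}_q[T]$; this gives a bijection $\mathbb{Z}_{\ge0}\to\mathbb{F}_q[T]$. For a subsequence $\omega$ of $p_0,p_1,\dots$ write $f\in\omega$ if $f$ occurs in $\omega$, and for $N\ge0$ define $r_N(\omega)=|\{(a,b)\in\mathbb{Z}_{\ge0}^2: p_a,p_b\in\omega,\ p_N=p_a+p_b,\ \deg p_a,\deg p_b\le\deg p_N,\ a<b\}|$, with $\deg 0=-\infty$. *)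

(* Defs.v *)
From HB Require Import structures.
From mathcomp Require Import all_boot all_order all_algebra all_field finmap.
From mathcomp Require Import all_classical all_reals all_analysis.

Set Implicit Arguments.
Unset Strict Implicit.
Unset Printing Implicit Defensive.

Import Order.TTheory GRing.Theory Num.Theory.

Local Open Scope classical_set_scope.
Local Open Scope ring_scope.

Lemma card_field_gt0 (F : finFieldType) : (0 < #|F|)%N.
Proof. exact: ltnW (finNzRing_gt1 F). Qed.

Definition digit0 (F : finFieldType) : 'I_#|F| := Ordinal (card_field_gt0 F).

Definition digit (F : finFieldType) (N i : nat) : 'I_#|F| :=
  Ordinal (ltn_pmod (N %/ #|F| ^ i) (card_field_gt0 F)).

(* The base-q digits of N of index > N all vanish, so for iota (digit0 F) = 0
   this sums over the whole base-q expansion of N. *)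
Definition digit_poly (F : finFieldType) (iota : 'I_#|F| -> F) (N : nat) :
  {poly F} := \poly_(i < N.+1) iota (digit F N i).

Definition is_subsequence (T : Type) (omega u : nat -> T) : Prop :=
  exists2 phi : nat -> nat,
    {homo phi : m n / (m < n)%N} & forall k, omega k = u (phi k).

(* Since size f = deg f + 1 and size 0 = 0, comparing sizes is comparing
   degrees with the convention deg 0 = -oo. *)
Definition repr_pairs (F : finFieldType) (iota : 'I_#|F| -> F)
    (omega : nat -> {poly F}) (N : nat) : set (nat * nat) :=
  let p := digit_poly iota in
  [set ab | [/\ range omega (p ab.1) /\ range omega (p ab.2),
                p N = p ab.1 + p ab.2,
                (size (p ab.1) <= size (p N))%N,
                (size (p ab.2) <= size (p N))%N
              & (ab.1 < ab.2)%N]].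

(* fset_set sends infinite sets to fset0; see repr_pairs_finite. *)
Definition repr_count (F : finFieldType) (iota : 'I_#|F| -> F)
    (omega : nat -> {poly F}) (N : nat) : nat :=
  #|` fset_set (repr_pairs iota omega N)|%fset.

Lemma ltn_exp_size_digit_poly (F : finFieldType) (iota : 'I_#|F| -> F)
    (a : nat) : injective iota -> iota (digit0 F) = 0 ->
  (a < #|F| ^ size (digit_poly iota a))%N.
Proof.
move=> iota_inj iota0; rewrite ltnNge; apply/negP => le_a.
have q1 : (1 < #|F|)%N := finNzRing_gt1 F.
have q0 : (0 < #|F|)%N := ltnW q1.
have a0 : (0 < a)%N by rewrite (leq_trans _ le_a) // expn_gt0 q0.
have /andP[lo hi] := trunc_log_bounds q1 a0.
set m := trunc_log _ a in lo hi.
have le_m : (size (digit_poly iota a) <= m)%N by exact: trunc_log_max.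
have := nth_default 0 le_m; rewrite coef_poly ltnS.
rewrite (leq_trans (ltnW (ltn_expl m q1)) lo) -iota0 => /iota_inj /(congr1 val).
have dlt : (a %/ #|F| ^ m < #|F|)%N by rewrite ltn_divLR ?expn_gt0 ?q0 // -expnS.
rewrite /= modn_small // => d0.
have : (0 < a %/ #|F| ^ m)%N by rewrite divn_gt0 ?expn_gt0 ?q0.
by rewrite d0.
Qed.

Lemma repr_pairs_finite (F : finFieldType) (iota : 'I_#|F| -> F)
    (omega : nat -> {poly F}) (N : nat) :
  injective iota -> iota (digit0 F) = 0 ->
  finite_set (repr_pairs iota omega N).
Proof.
move=> iota_inj iota0.
set M := (#|F| ^ size (digit_poly iota N))%N.
apply: (@sub_finite_set _ _ (`I_M `*` `I_M)); last exact: finite_setX.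
have q0 := card_field_gt0 F.
move=> [a b] [_ _ /= sa sb _]; split => /=.
  by apply: leq_trans (ltn_exp_size_digit_poly a iota_inj iota0) _; rewrite leq_pexp2l.
by apply: leq_trans (ltn_exp_size_digit_poly b iota_inj iota0) _; rewrite leq_pexp2l.
Qed.

(* Main.v *)
Require Import Defs.
From HB Require Import structures.
From mathcomp Require Import all_boot all_order all_algebra all_field finmap.
From mathcomp Require Import all_classical all_reals all_analysis.
From mathcomp Require Import lra ring zify.

(** Erdos's probabilistic construction, run one degree at a time.  Write
    [s_d = sqrt (d q^d)].  Suppose the part [B] of the set in degrees below [d]
    has about [s_d] elements, and choose its part [S] in degree [d] at random with
    density about [s_d / q^d].  For [f] of degree [d], the number of [b] in [B]
    with [f - b] in [S] is a sum of independent variables with mean of order [d],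
    and the number of pairs inside [S] with sum [f] is a sum over disjoint pairs
    with mean of order [d].  Their exponential moments bound the probability of a
    deviation by [e^(-c d)], which beats the [q^(d+1)] choices of [f], so some [S]
    is good for all [f] at once; it has about [s_d] elements, so the step repeats.
    Polynomials are replaced by their indices, and [f - g] by a map on indices. *)

Import Order.TTheory GRing.Theory Num.Theory.
Local Open Scope ring_scope.

(** * Random subsets *)

(** The probability that a random subset, containing each point independently with probability [p],
    equals [S]. Probabilities and expectations are then finite sums over [S]. *)
Definition bernoulli_weight {R : realType} {I : finType} (p : R) (S : {set I}) : R :=
  \prod_i (if i \in S then p else 1 - p).

Lemma bernoulli_weight_ge0 {R : realType} {I : finType} (p : R) (S : {set I}) :
  0 <= p <= 1 -> 0 <= bernoulli_weight p S.
Proof.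
by case/andP=> p0 p1; apply: prodr_ge0 => i _; case: ifP => _; rewrite ?subr_ge0.
Qed.

Lemma prod_if_const {R : comNzRingType} {I : finType} (U : {set I}) (x : R) :
  \prod_i (if i \in U then x else 1) = x ^+ #|U|.
Proof. by rewrite -big_mkcond /= prodr_const. Qed.

(** Independence in algebraic form: expanding the product over [i] of [p x_i + (1 - p)], with
    [x_i = c] on [U] and [1] elsewhere, gives one term per subset. *)
Lemma bernoulli_expect_exp {R : realType} {I : finType} (p c : R) (U : {set I}) :
  \sum_S bernoulli_weight p S * c ^+ #|S :&: U| = (1 + (c - 1) * p) ^+ #|U|.
Proof.
rewrite -prod_if_const.
under [RHS]eq_bigr => i _.
  rewrite (_ : (if _ then _ else _) = p * (if i \in U then c else 1) + (1 - p));
    last by case: ifP => _; ring.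
  over.
rewrite bigA_distr; apply: eq_bigr => S _.
rewrite -prod_if_const -big_split /=; apply: eq_bigr => i _.
by rewrite inE; case: (i \in S) => //=; rewrite mulr1.
Qed.

Lemma sum_bernoulli_weight {R : realType} {I : finType} (p : R) :
  \sum_(S : {set I}) bernoulli_weight p S = 1.
Proof.
have := bernoulli_expect_exp p 1 (@finset.set0 I).
rewrite finset.cards0 expr0 => <-; apply: eq_bigr => S _; by rewrite expr1n mulr1.
Qed.

Lemma bernoulli_sub {R : realType} {I : finType} (p : R) (L : {set I}) :
  \sum_(S : {set I} | L \subset S) bernoulli_weight p S = p ^+ #|L|.
Proof.
rewrite -prod_if_const.
under [RHS]eq_bigr => i _.
  rewrite (_ : (if _ then _ else _) = p + (if i \in L then 0 else 1) * (1 - p));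
    last by case: ifP => _; ring.
  over.
rewrite bigA_distr big_mkcond; apply: eq_bigr => S _ /=.
case: ifPn => [LS|/fintype.subsetPn[i iL iS]].
  apply: eq_bigr => i _; case: (boolP (i \in S)) => // iS.
  by rewrite ifN ?mul1r //; apply: contra iS; apply: (fintype.subsetP LS).
by rewrite (bigD1 i) //= (negbTE iS) iL !mul0r.
Qed.

(** With [e^(1/2) <= 2 <= e], exponential moments can be taken to base 2 or 1/2, which keeps their
    exponents natural numbers. *)
Lemma expR_ge2 {R : realType} : 2 <= expR (1 : R).
Proof. by have := expR_ge1Dx (1 : R). Qed.

Lemma expR_half_le2 {R : realType} : expR (2^-1 : R) <= 2.
Proof.
have := expR_ge1Dx (- 2^-1 : R); rewrite expRN => h.
have e0 := expR_gt0 (2^-1 : R).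
have : (1 + - 2^-1) * expR (2^-1) <= (expR (2^-1))^-1 * expR (2^-1) :> R.
  by rewrite ler_wpM2r // ltW.
rewrite mulVf ?gt_eqF //; lra.
Qed.

Lemma pow2_le_expR {R : realType} (n : nat) : 2 ^+ n <= expR (n%:R : R).
Proof.
rewrite -[n%:R]mulr1 expRM_natl; apply: lerXn2r; rewrite ?nnegrE ?expR_ge0 //.
exact: expR_ge2.
Qed.

Lemma expR_half_le_pow2 {R : realType} (n : nat) : expR (n%:R / 2 : R) <= 2 ^+ n.
Proof.
rewrite expRM_natl; apply: lerXn2r; rewrite ?nnegrE ?expR_ge0 //.
exact: expR_half_le2.
Qed.

Lemma one_plus_exp_le {R : realType} (x : R) (n : nat) : -1 <= x ->
  (1 + x) ^+ n <= expR (n%:R * x).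
Proof.
move=> x1; rewrite expRM_natl; apply: lerXn2r; rewrite ?nnegrE ?expR_ge0 //.
  lra.
exact: expR_ge1Dx.
Qed.

Lemma bernoulli_markov {R : realType} {I : finType} (p x : R) (E : pred {set I})
    (f : {set I} -> R) : 0 <= p <= 1 ->
  (forall S, 0 <= f S) -> (forall S, E S -> expR x <= f S) ->
  \sum_(S | E S) bernoulli_weight p S <=
    expR (- x) * \sum_S bernoulli_weight p S * f S.
Proof.
move=> p01 f0 fE; rewrite big_distrr big_mkcond /=; apply: ler_sum => S _.
have w0 := bernoulli_weight_ge0 p S p01.
case: ifPn => [ES|_]; last by rewrite !mulr_ge0 ?expR_ge0.
rewrite mulrCA ler_peMr // -(expRK x) expRN lnK ?posrE ?expR_gt0 //.
by rewrite mulrC ler_pdivlMr ?expR_gt0 // mul1r fE.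
Qed.

(** Chernoff's method with base 1/2 and [m = p #|U|]: the moment [(1 - p/2)^#|U|] is at most
    [e^(-m/2)], and Markov's inequality costs a factor [e^(m/4)]. *)
Lemma bernoulli_lower_tail {R : realType} {I : finType} (p : R) (U : {set I}) :
  0 <= p <= 1 ->
  \sum_(S : {set I} | #|S :&: U|%:R < p * #|U|%:R / 4) bernoulli_weight p S
    <= expR (- (p * #|U|%:R / 4)).
Proof.
move=> p01; set m := p * _.
apply: le_trans (@bernoulli_markov _ _ p (- (m / 4)) _
  (fun S => 2^-1 ^+ #|S :&: U|) p01 _ _) _ => [S|S lt_S|].
- by rewrite exprn_ge0 // invr_ge0.
- rewrite exprVn expRN lef_pV2 ?posrE ?expR_gt0 ?exprn_gt0 //.
  by apply: le_trans (pow2_le_expR _) _; rewrite ler_expR ltW.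
rewrite bernoulli_expect_exp opprK.
apply: (@le_trans _ _ (expR (m / 4) * expR (- (m / 2)))).
  rewrite ler_wpM2l ?expR_ge0 //.
  apply: le_trans (one_plus_exp_le _ _ _) _; first lra.
  by rewrite ler_expR /m; lra.
by rewrite -expRD ler_expR; lra.
Qed.

(** The same with base 2: the moment [(1 + p)^#|U|] is at most [e^m], while
    [2^n >= e^(n/2) > e^(2m)] as soon as [n > 4m]. *)
Lemma bernoulli_upper_tail {R : realType} {I : finType} (p : R) (U : {set I}) :
  0 <= p <= 1 ->
  \sum_(S : {set I} | 4 * (p * #|U|%:R) < #|S :&: U|%:R) bernoulli_weight p S
    <= expR (- (p * #|U|%:R)).
Proof.
move=> p01; set m := p * _.
apply: le_trans (@bernoulli_markov _ _ p (2 * m) _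
  (fun S => 2 ^+ #|S :&: U|) p01 _ _) _ => [S|S lt_S|].
- by rewrite exprn_ge0.
- by apply: le_trans (expR_half_le_pow2 _); rewrite ler_expR; lra.
rewrite bernoulli_expect_exp.
apply: (@le_trans _ _ (expR (- (2 * m)) * expR m)).
  rewrite ler_wpM2l ?expR_ge0 //.
  apply: le_trans (one_plus_exp_le _ _ _) _; first lra.
  by rewrite ler_expR /m; lra.
by rewrite -expRD ler_expR; lra.
Qed.

Lemma sum_exp_powerset {R : comNzRingType} {I : finType} (H : {set I}) (x : R) :
  \sum_(K : {set I} | K \subset H) x ^+ #|K| = (1 + x) ^+ #|H|.
Proof.
rewrite -prod_if_const.
under [RHS]eq_bigr => i _.
  rewrite (_ : (if _ then _ else _) = (if i \in H then x else 0) + 1);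
    last by case: ifP => _; ring.
  over.
rewrite bigA_distr big_mkcond; apply: eq_bigr => K _ /=.
case: ifPn => [KH|/fintype.subsetPn[i iK iH]].
  rewrite -prod_if_const; apply: eq_bigr => i _.
  by case: ifP => // iK; rewrite (fintype.subsetP KH).
by rewrite (bigD1 i) //= iK (negbTE iH) mul0r.
Qed.

(* [2 ^ #|Z S|], for [Z S] the set of pairs inside [S], counts the subsets [K] of
   [Z S]; [K \subset Z S] forces the [2 * #|K|] distinct points of
   [K :|: sigma @: K] to lie in [S]. *)
Lemma bernoulli_pairs_tail {R : realType} {I : finType} (p a : R)
    (sigma : I -> I) (H : {set I}) : 0 <= p <= 1 -> injective sigma ->
  (forall i, i \in H -> sigma i \notin H) ->
  \sum_(S : {set I} | a < #|[set i in H | (i \in S) && (sigma i \in S)]|%:R)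
     bernoulli_weight p S <= expR (p ^+ 2 * #|I|%:R - a / 2).
Proof.
move=> p01 sigma_inj sigmaH.
pose Z (S : {set I}) := [set i in H | (i \in S) && (sigma i \in S)].
apply: le_trans (@bernoulli_markov _ _ p (a / 2) (fun S => a < #|Z S|%:R)
  (fun S => 2 ^+ #|Z S|) p01 _ _) _ => [S|S lt_S|].
- by rewrite exprn_ge0.
- by apply: le_trans (expR_half_le_pow2 _); rewrite ler_expR; lra.
rewrite addrC expRD ler_wpM2l ?expR_ge0 //.
have -> : \sum_(S : {set I}) bernoulli_weight p S * 2 ^+ #|Z S| =
    \sum_(K : {set I} | K \subset H) (p ^+ 2) ^+ #|K|.
  transitivity (\sum_(S : {set I}) \sum_(K : {set I} | K \subset Z S)
    bernoulli_weight p S).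
    apply: eq_bigr => S _; rewrite sumr_const -[RHS]mulr_natr -natrX.
    by rewrite -card_powerset; congr (_ * _%:R); apply: eq_card => K; rewrite inE.
  rewrite (exchange_big_dep (fun K : {set I} => K \subset H)) /=; last first.
    move=> S K _ /fintype.subset_trans; apply.
    by apply/fintype.subsetP => i; rewrite inE => /andP[].
  apply: eq_bigr => K KH.
  have -> : (p ^+ 2) ^+ #|K| = p ^+ #|K :|: sigma @: K|.
    rewrite cardsU card_imset // (_ : K :&: _ = finset.set0) ?finset.cards0.
      by rewrite subn0 addnn -mul2n exprM.
    apply/eqP; rewrite -finset.subset0; apply/fintype.subsetP => i.
    rewrite inE => /andP[iK /imsetP[j jK ij]].
    by have := sigmaH j (fintype.subsetP KH _ jK); rewrite -ij (fintype.subsetP KH _ iK).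
  rewrite -bernoulli_sub; apply: eq_bigl => S.
  rewrite finset.subUset; apply/fintype.subsetP/andP =>
    [KZ|[/fintype.subsetP KS /fintype.subsetP sKS] i iK].
    split; apply/fintype.subsetP => i; first by move/KZ; rewrite inE => /and3P[].
    by case/imsetP => j /KZ + ->; rewrite inE => /and3P[].
  by rewrite inE (fintype.subsetP KH) // KS // sKS // imset_f.
(* The sum is [(1 + p^2)^#|H| <= e^(p^2 #|H|)], and [#|H|] is bounded by [#|I|]. *)
rewrite sum_exp_powerset; apply: le_trans (one_plus_exp_le _ _ _) _.
  by rewrite (le_trans _ (exprn_ge0 _ _)) //; case/andP: p01.
rewrite ler_expR mulrC ler_wpM2l ?exprn_ge0 ?ler_nat ?max_card //.
by case/andP: p01.
Qed.

(** If every [S] lay in some event, the total weight 1 would be at most [#|J| eps]. *)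
Lemma bernoulli_union_bound {R : realType} {I J : finType} (p eps : R)
    (E : J -> pred {set I}) : 0 <= p <= 1 ->
  (forall j, \sum_(S : {set I} | E j S) bernoulli_weight p S <= eps) ->
  #|J|%:R * eps < 1 -> exists S : {set I}, forall j, ~~ E j S.
Proof.
move=> p01 Eeps Jeps.
case: (boolP [exists S : {set I}, [forall j, ~~ E j S]]) => [/existsP[S /forallP ES]|].
  by exists S.
rewrite negb_exists => /forallP noS; move: Jeps; rewrite ltNge => /negP[].
rewrite -[leLHS](@sum_bernoulli_weight R I p).
apply: (@le_trans _ _ (\sum_j \sum_(S : {set I} | E j S) bernoulli_weight p S)).
  rewrite (exchange_big_dep xpredT) //=; apply: ler_sum => S _.
  have := noS S; rewrite negb_forall => /existsP[j]; rewrite negbK => ESj.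
  rewrite (bigD1 j) //= lerDl sumr_ge0 // => i _.
  exact: bernoulli_weight_ge0.
by rewrite mulr_natl -sumr_const; apply: ler_sum => j _; exact: Eeps.
Qed.

(** Each way to fail has probability at most [e^(-(l + 4))], which beats their number since
    [#|I| <= e^l]. The strict [rank] inequality keeps at most one point of each pair
    [{i, sigma j i}] and drops fixed points, so the pairs are disjoint. *)
Lemma exists_equidistributed_set {R : realType} {I : finType} (rank : I -> nat)
    (sigma : I -> I -> I) (B D : {set I}) (p l : R) : 0 <= p <= 1 ->
  (forall j, involutive (sigma j)) ->
  #|I|%:R <= expR l -> 0 <= l -> 4 * l + 16 <= p * #|B|%:R -> (#|B| <= #|D|)%N ->
  exists S : {set I},
    [/\ forall j, p * #|B|%:R / 4 <= #|S :&: sigma j @: B|%:R <= 4 * (p * #|B|%:R),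
        p * #|D|%:R / 4 <= #|S :&: D|%:R <= 4 * (p * #|D|%:R)
      & forall j,
        #|[set i in S | (sigma j i \in S) && (rank i < rank (sigma j i))%N]|%:R
          <= 2 * (p ^+ 2 * #|I|%:R + l + 4)].
Proof.
move=> p01 sigmaK Il l0 lB BD.
have [p0 p1] := andP p01.
have sigma_inj j : injective (sigma j) := inv_inj (sigmaK j).
have BI : (#|B| <= #|I|)%N := max_card _.
have I1 : (1 <= #|I|)%N.
  rewrite lt0n; apply/eqP => I0; move: BI; rewrite I0 leqn0 => /eqP B0.
  by move: lB; rewrite B0 mulr0; lra.
pose U (o : option I) := if o is Some j then sigma j @: B else D.
pose H j := [set i | (rank i < rank (sigma j i))%N].
(* Chosen so that the exponent [p^2 #|I| - a/2] of [bernoulli_pairs_tail] is [-(l + 4)]. *)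
pose a := 2 * (p ^+ 2 * #|I|%:R + l + 4).
(* The failures: too few ([true]) or too many ([false]) points of [S] in [D] ([None]) or in a
   reflection of [B] ([Some j]), and too many pairs inside [S] ([inr j]). *)
pose E (x : (option I * bool) + I) (S : {set I}) :=
  match x with
  | inl (o, true) => #|S :&: U o|%:R < p * #|U o|%:R / 4
  | inl (o, false) => 4 * (p * #|U o|%:R) < #|S :&: U o|%:R
  | inr j => a < #|[set i in H j | (i \in S) && (sigma j i \in S)]|%:R
  end.
have BU o : p * #|B|%:R <= p * #|U o|%:R.
  rewrite ler_wpM2l // ler_nat; case: o => [j|] //=.
  by rewrite card_imset.
have Eeps x : \sum_(S : {set I} | E x S) bernoulli_weight p S <= expR (- (l + 4)).
  case: x => [[w b]|j]; first case: b.
  - rewrite /=; apply: le_trans (bernoulli_lower_tail _ _ p01) _; rewrite ler_expR.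
    by have := BU w; lra.
  - rewrite /=; apply: le_trans (bernoulli_upper_tail _ _ p01) _; rewrite ler_expR.
    by have := BU w; lra.
  - apply: le_trans (bernoulli_pairs_tail _ _ _ _ p01 (sigma_inj j) _) _.
      by move=> i; rewrite !inE sigmaK -leqNgt => /ltnW.
    by rewrite ler_expR /a; lra.
(* There are [3 #|I| + 2 <= 5 #|I|] events, fewer than [16 #|I| <= e^4 e^l]. *)
have Ilt : #|{: (option I * bool) + I}|%:R * expR (- (l + 4)) < 1 :> R.
  rewrite card_sum card_prod card_option card_bool expRN.
  rewrite ltr_pdivrMr ?expR_gt0 // mul1r expRD.
  have e4 : 16 <= expR 4 :> R.
    by have := @pow2_le_expR R 4; rewrite (_ : 2 ^+ 4 = 16) //; ring.
  apply: (@lt_le_trans _ _ (#|I|%:R * 16)).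
    by rewrite -natrM ltr_nat; lia.
  by apply: ler_pM.
have [S ES] := bernoulli_union_bound _ _ _ p01 Eeps Ilt.
exists S; split=> [j||j].
- have := ES (inl (Some j, true)); have := ES (inl (Some j, false)).
  by rewrite /= !card_imset // -!leNgt => -> ->.
- have := ES (inl (None, true)); have := ES (inl (None, false)).
  by rewrite /= -!leNgt => -> ->.
- have := ES (inr j); rewrite /= -leNgt; apply: le_trans.
  rewrite ler_nat subset_leq_card //; apply/fintype.subsetP => i.
  by rewrite !inE => /and3P[-> -> ->].
Qed.

(** * Extending the set by one degree *)

Definition count_below (A : pred nat) (m : nat) : nat := #|[set a : 'I_m | A a]|.

(** Only the smaller member [a] is bounded by [m]; for [N < m = q ^ n], [degree_subtraction] bounds
    the other member as well. *)
Definition pairs_below (sigma : nat -> nat -> nat) (A : pred nat) (m N : nat) : nat :=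
  #|[set a : 'I_m | [&& A a, A (sigma N a) & (a < sigma N a)%N]]|.

(* [sigma N a] stands for the index of [p_N - p_a]; [m < q ^ n] says that [p_m]
   has degree less than [n]. *)
Definition degree_subtraction (q : nat) (sigma : nat -> nat -> nat) : Prop :=
  [/\ forall N, involutive (sigma N),
      forall n N a, (N < q ^ n)%N -> (a < q ^ n)%N -> (sigma N a < q ^ n)%N
    & forall n N a, (q ^ n <= N)%N -> (a < q ^ n)%N -> (q ^ n <= sigma N a)%N].

Lemma card_ord_below (A : pred nat) (k m : nat) : (k <= m)%N ->
  #|[set a : 'I_m | A a && (a < k)%N]| = count_below A k.
Proof.
move=> km; rewrite /count_below.
have wi : injective (widen_ord km) by move=> x y /(congr1 val) /= /val_inj.
rewrite -(card_imset _ wi); apply: eq_card => a.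
rewrite inE; apply/andP/imsetP => [[Aa ak]|[b + ->]]; last by rewrite inE /= => ->.
by exists (Ordinal ak); [rewrite inE|exact: val_inj].
Qed.

Lemma count_below_predT (k : nat) : count_below predT k = k.
Proof. by rewrite /count_below -[RHS]card_ord; apply: eq_card => a; rewrite inE. Qed.

Lemma card_ord_above (k m : nat) : (k <= m)%N ->
  #|[set a : 'I_m | (k <= a)%N]| = (m - k)%N.
Proof.
move=> km; have := finset.cardsC [set a : 'I_m | predT (val a) && (a < k)%N].
rewrite card_ord_below // count_below_predT card_ord => /(canRL (addKn k)) <-.
by apply: eq_card => a; rewrite !inE /= leqNgt.
Qed.

(** [A'] is [A] below [q ^ d] and [S] from there on. In a pair with sum of degree [d] the larger
    member has degree [d]. Either the smaller one lies in [B], and the pair is counted by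
    [S :&: sg N @: B], or both lie in [S]. The last term may also count points of [S] below [q ^ d],
    so it serves only in the upper bound. *)
Lemma extend_set (q d : nat) (sigma : nat -> nat -> nat) (A : pred nat)
    (S : {set 'I_(q ^ d.+1)}) (sg : 'I_(q ^ d.+1) -> 'I_(q ^ d.+1) -> 'I_(q ^ d.+1)) :
  (0 < q)%N -> degree_subtraction q sigma ->
  (forall i j, val (sg i j) = sigma i j) ->
  let B := [set i : 'I_(q ^ d.+1) | A i && (i < q ^ d)%N] in
  let D := [set i : 'I_(q ^ d.+1) | (q ^ d <= i)%N] in
  exists A' : pred nat,
    [/\ forall n, (n < q ^ d)%N -> A' n = A n,
        count_below A' (q ^ d.+1) = (count_below A (q ^ d) + #|S :&: D|)%N
      & forall N : 'I_(q ^ d.+1), (q ^ d <= N)%N ->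
        (#|S :&: sg N @: B| <= pairs_below sigma A' (q ^ d.+1) N
          <= #|S :&: sg N @: B| +
             #|[set i in S | (sg N i \in S) && (i < sg N i)%N]|)%N].
Proof.
move=> q0 [sigmaK sigma_lt sigma_ge] sgE B D.
have qd : (q ^ d <= q ^ d.+1)%N by rewrite leq_pexp2l.
pose A' n := if (n < q ^ d)%N then A n else n \in [seq val i | i in S].
have A'lt n : (n < q ^ d)%N -> A' n = A n by rewrite /A' => ->.
have A'ge (i : 'I_(q ^ d.+1)) : (q ^ d <= i)%N -> A' i = (i \in S).
  by move=> qi; rewrite /A' ltnNge qi /= fintype.mem_image //; exact: val_inj.
have sgK N : involutive (sg N).
  by move=> i; apply: val_inj; rewrite !sgE sigmaK.
have sg_inj N : injective (sg N) := inv_inj (sgK N).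
exists A'; split=> // [|N qN].
  rewrite -(card_ord_below A _ _ qd).
  rewrite {1}/count_below -(cardsID [set i : 'I_(q ^ d.+1) | (i < q ^ d)%N]).
  congr addn; apply: eq_card => i; rewrite !inE.
    by case: ltnP => iq; rewrite ?andbF // A'lt.
  by rewrite -leqNgt andbC; case: leqP => iq; rewrite ?andbF ?andbT // A'ge.
have memX i : (i \in S :&: sg N @: B) =
    [&& i \in S, A (sg N i) & (sg N i < q ^ d)%N].
  rewrite inE; congr andb; apply/imsetP/idP => [[b + ->]|h].
    by rewrite inE sgK.
  by exists (sg N i); rewrite ?sgK // inE.
(* [pairs_below] indexes a pair by its smaller member and [S :&: sg N @: B] by its larger one;
   [sg N] exchanges the two. *)
rewrite -(card_imset (S :&: sg N @: B) (sg_inj N)) /pairs_below.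
apply/andP; split.
  apply/subset_leq_card/fintype.subsetP => _ /imsetP[i + ->].
  rewrite memX => /and3P[iS Ai iq]; rewrite inE -!sgE sgK.
  have qi : (q ^ d <= i)%N by rewrite -(sgK N i) sgE sigma_ge.
  by rewrite A'lt // A'ge // Ai iS /= (leq_trans iq).
apply: leq_trans (leq_card_setU _ _).
apply/subset_leq_card/fintype.subsetP => a; rewrite !inE -!sgE => /and3P[Aa As lt_a].
case: (ltnP a (q ^ d)) => aq; last first.
  have sq : (q ^ d <= sg N a)%N by exact: leq_trans aq (ltnW lt_a).
  by rewrite -(A'ge a) // Aa -(A'ge (sg N a)) // As lt_a orbT.
apply/orP; left; apply/imsetP; exists (sg N a); rewrite ?sgK // memX sgK.
rewrite -(A'ge (sg N a)); last by rewrite sgE sigma_ge.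
by rewrite As -(A'lt a) // Aa.
Qed.

Definition layer_scale (R : realType) (q d : nat) : R := Num.sqrt (d * q ^ d)%:R.

Lemma layer_scale_sqr (R : realType) (q d : nat) :
  layer_scale R q d ^+ 2 = d%:R * q%:R ^+ d.
Proof. by rewrite sqr_sqrtr ?ler0n // natrM natrX. Qed.

Lemma layer_scale_ge0 (R : realType) (q d : nat) : 0 <= layer_scale R q d.
Proof. exact: sqrtr_ge0. Qed.

Lemma layer_scale_gt0 (R : realType) (q d : nat) :
  (0 < q)%N -> (0 < d)%N -> 0 < layer_scale R q d.
Proof. by move=> q0 d0; rewrite sqrtr_gt0 ltr0n muln_gt0 d0 expn_gt0 q0. Qed.

(** The squares have ratio [q (d + 1) / d], between [q] and [2q]; [7/5] is a rational below the
    square root of 2. *)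
Lemma layer_scaleS (R : realType) (q d : nat) : (2 <= q)%N -> (1 <= d)%N ->
  7 / 5 * layer_scale R q d <= layer_scale R q d.+1 <= 2 * q%:R * layer_scale R q d.
Proof.
move=> q2 d1.
have q2R : 2 <= q%:R :> R by rewrite ler_nat.
have d1R : 1 <= d%:R :> R by rewrite ler1n.
have s0 := layer_scale_ge0 R q d; have s0' := layer_scale_ge0 R q d.+1.
have Q0 : 0 <= q%:R ^+ d :> R by rewrite exprn_ge0.
have E := layer_scale_sqr R q d; have E' := layer_scale_sqr R q d.+1.
rewrite (exprS q%:R) -natr1 in E'.
have dQ0 : 0 <= d%:R * q%:R ^+ d :> R by rewrite mulr_ge0.
have dQ : q%:R ^+ d <= d%:R * q%:R ^+ d :> R by rewrite ler_peMl.
have E'' : layer_scale R q d.+1 ^+ 2 =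
    q%:R * (d%:R * q%:R ^+ d) + q%:R * q%:R ^+ d by rewrite E'; ring.
apply/andP; split.
- have c0 : 0 <= 7 / 5 :> R by lra.
  rewrite -ler_sqr ?nnegrE ?mulr_ge0 //.
  rewrite exprMn E E''.
  have : 2 * (d%:R * q%:R ^+ d) <= q%:R * (d%:R * q%:R ^+ d) :> R by rewrite ler_wpM2r.
  have : 0 <= q%:R * q%:R ^+ d :> R by rewrite mulr_ge0.
  lra.
- rewrite -ler_sqr ?nnegrE ?mulr_ge0 //.
  rewrite !exprMn E E''.
  have : q%:R * q%:R ^+ d <= q%:R * (d%:R * q%:R ^+ d) :> R by rewrite ler_wpM2l.
  have : q%:R * (d%:R * q%:R ^+ d) <= q%:R ^+ 2 * (d%:R * q%:R ^+ d) :> R.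
    by rewrite ler_wpM2r // expr2 ler_peMl //; lra.
  have : 0 <= q%:R ^+ 2 * (d%:R * q%:R ^+ d) :> R by rewrite mulr_ge0 ?exprn_ge0.
  lra.
Qed.

(** The term [48 M q] bounds the pairs with one member in the old set; the rest bounds
    [2 (p^2 q^(d+1) + l + 4) / d], the pairs inside the new layer. *)
Definition layer_bound {R : realType} (q : nat) (M : R) : R :=
  48 * M * q%:R + 288 * q%:R ^+ 3 + 4 * q%:R + 8.

(* The density of the random layer is [p = 12 q s / q ^ d], where
   [s = sqrt (d q ^ d)]; the reflection [N - A] of the set [A], of size about [s],
   then meets the random layer in about [d] elements. *)
Lemma next_layer (R : realType) (q d : nat) (sigma : nat -> nat -> nat)
    (A : pred nat) (M : R) : (2 <= q)%N -> degree_subtraction q sigma ->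
  (13 <= d)%N -> (144 * q ^ 2 * d <= q ^ d)%N -> 120 * q%:R ^+ 2 <= M ->
  3 / 2 * layer_scale R q d <= (count_below A (q ^ d))%:R <= M * layer_scale R q d ->
  exists A' : pred nat,
    [/\ forall n, (n < q ^ d)%N -> A' n = A n,
        3 / 2 * layer_scale R q d.+1 <= (count_below A' (q ^ d.+1))%:R
          <= M * layer_scale R q d.+1
      & forall N, (q ^ d <= N < q ^ d.+1)%N ->
        (d%:R : R) <= (pairs_below sigma A' (q ^ d.+1) N)%:R <= layer_bound q M * d%:R].
Proof.
move=> q2 sub_sigma d13 qd_large Mq /andP[lo hi].
have q0 : (0 < q)%N := ltnW q2.
have [sigmaK sigma_lt _] := sub_sigma.
pose sg (i j : 'I_(q ^ d.+1)) := Ordinal (sigma_lt _ _ _ (ltn_ord i) (ltn_ord j)).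
have sgE i j : val (sg i j) = sigma i j by [].
have sgK i : involutive (sg i) by move=> j; apply: val_inj; rewrite /= sigmaK.
set b : R := (count_below A (q ^ d))%:R in lo hi *.
have /andP[s'lo s'hi] := layer_scaleS R q d q2 (ltn_trans (ltn0Sn _) d13).
have s0 := layer_scale_gt0 R q d q0 (ltn_trans (ltn0Sn _) d13).
have sE := layer_scale_sqr R q d.
set s := layer_scale R q d in lo hi s'lo s'hi s0 sE *.
set s' := layer_scale R q d.+1 in s'lo s'hi *.
have Q0 : 0 < q%:R ^+ d :> R by rewrite exprn_gt0 // ltr0n.
have q2R : 2 <= q%:R :> R by rewrite ler_nat.
have d13R : 13 <= d%:R :> R by rewrite ler_nat.
have Qlarge : 144 * q%:R ^+ 2 * d%:R <= q%:R ^+ d :> R.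
  by rewrite -!natrX -!natrM ler_nat.
set Q := q%:R ^+ d in sE Q0 Qlarge *.
pose p := 12 * q%:R * s / Q.
have pQ : p * Q = 12 * q%:R * s by rewrite /p divfK // gt_eqF.
have p0 : 0 <= p by rewrite /p divr_ge0 ?mulr_ge0 // ltW.
have ps : p * s = 12 * q%:R * d%:R.
  have -> : p * s = 12 * q%:R * s ^+ 2 / Q by rewrite /p; ring.
  by rewrite sE mulrA mulfK // gt_eqF.
(* This is where [q ^ d] must be large: [p <= 1] amounts to [144 q^2 d Q <= Q^2]. *)
have p1 : p <= 1.
  rewrite ler_pdivrMr // mul1r -ler_sqr ?nnegrE ?mulr_ge0 ?(ltW Q0) ?(ltW s0) //.
  have -> : (12 * q%:R * s) ^+ 2 = 144 * q%:R ^+ 2 * d%:R * Q by rewrite exprMn sE; ring.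
  by rewrite [leRHS]expr2 ler_wpM2r // ltW.
have qd : (q ^ d <= q ^ d.+1)%N by rewrite leq_pexp2l.
pose B := [set i : 'I_(q ^ d.+1) | A i && (i < q ^ d)%N].
pose D := [set i : 'I_(q ^ d.+1) | (q ^ d <= i)%N].
have BE : #|B|%:R = b :> R by rewrite card_ord_below.
have DN : #|D| = (q.-1 * q ^ d)%N.
  by rewrite card_ord_above // expnS -{2}(mul1n (q ^ d)%N) -mulnBl subn1.
have DE : #|D|%:R = (q%:R - 1) * Q :> R.
  by rewrite DN natrM natrX -subn1 natrB.
have BD : (#|B| <= #|D|)%N.
  rewrite DN card_ord_below //.
  apply: (@leq_trans (q ^ d)%N).
    by rewrite /count_below (leq_trans (max_card _)) ?card_ord.
  by rewrite leq_pmull // -subn1 subn_gt0.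
(* From [q <= e^q] follows [q^(d+1) <= e^l], a crude bound but still linear in [d]. *)
pose l : R := d.+1%:R * q%:R.
have Il : #|'I_(q ^ d.+1)|%:R <= expR l.
  rewrite card_ord natrX /l expRM_natl lerXn2r ?nnegrE ?expR_ge0 //.
  by apply: le_trans (expR_ge1Dx _); lra.
have l0 : 0 <= l by rewrite /l mulr_ge0.
have lE : l = d%:R * q%:R + q%:R by rewrite /l -natr1 mulrDl mul1r.
have dq : 13 * q%:R <= d%:R * q%:R :> R by rewrite ler_wpM2r //; lra.
have pb : 18 * (d%:R * q%:R) <= p * b.
  have : p * (3 / 2 * s) <= p * b by rewrite ler_wpM2l.
  by rewrite mulrCA ps; lra.
have pb' : p * b <= 12 * (M * q%:R * d%:R).
  have : p * b <= p * (M * s) by rewrite ler_wpM2l.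
  by rewrite mulrCA ps; lra.
have lB : 4 * l + 16 <= p * #|B|%:R by rewrite BE lE; lra.
have p01 : 0 <= p <= 1 by rewrite p0.
have [S [SB SD Spairs]] :=
  exists_equidistributed_set val sg B D p l p01 sgK Il l0 lB BD.
have [A' [A'lt A'count A'pairs]] := extend_set q d sigma A S sg q0 sub_sigma sgE.
exists A'; split=> // [|N /andP[qN Nq]].
  (* The new layer has between [3 q (q - 1) s] and [48 q (q - 1) s] elements. Below,
     [3/2 s + 3 q (q - 1) s >= 3 q s >= 3/2 s']. Above, [48 q^2 <= 2/5 M] because [120 q^2 <= M],
     and [7/5 M s <= M s']. *)
  rewrite A'count natrD -/b.
  move: SD; rewrite DE mulrCA pQ => /andP[SDlo SDhi].
  have qs0 : 0 <= q%:R * s by rewrite mulr_ge0 // ltW.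
  have qs : q%:R * s <= (q%:R - 1) * (q%:R * s) by rewrite ler_peMl //; lra.
  have Ms : 120 * q%:R ^+ 2 * s <= M * s by rewrite ler_wpM2r // ltW.
  have M0 : 0 <= M by rewrite (le_trans _ Mq) // mulr_ge0 ?exprn_ge0.
  have Ms' : M * (7 / 5 * s) <= M * s' by rewrite ler_wpM2l.
  apply/andP; split; lra.
have := A'pairs (Ordinal Nq) qN; rewrite -/B => /andP[lo' hi'].
have /andP[SBlo SBhi] := SB (Ordinal Nq); have Sp := Spairs (Ordinal Nq).
rewrite BE in SBlo SBhi.
rewrite card_ord natrX (exprS q%:R) -/Q in Sp.
have p2Q : p ^+ 2 * (q%:R * Q) = 144 * q%:R ^+ 3 * d%:R.
  have -> : p ^+ 2 * (q%:R * Q) = q%:R * p * (p * Q) by ring.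
  rewrite pQ; have -> : q%:R * p * (12 * q%:R * s) = 12 * q%:R ^+ 2 * (p * s) by ring.
  by rewrite ps; ring.
rewrite p2Q in Sp.
apply/andP; split.
  apply: le_trans (_ : _ <= #|S :&: sg (Ordinal Nq) @: B|%:R) _; last by rewrite ler_nat.
  apply: le_trans SBlo; have : d%:R * 2 <= d%:R * q%:R :> R by rewrite ler_wpM2l.
  lra.
move: hi'; rewrite -(ler_nat R) natrD => /le_trans; apply.
rewrite /layer_bound.
have qd2 : 2 * 1 <= d%:R * 1 :> R by lra.
have : q%:R * 1 <= q%:R * d%:R :> R by rewrite ler_wpM2l //; lra.
rewrite lE in Sp.
lra.
Qed.

(** * Polynomials and their indices *)

Lemma eq_from_digits (q a b : nat) : (1 < q)%N ->
  (forall i, (a %/ q ^ i) %% q = (b %/ q ^ i) %% q)%N -> a = b.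
Proof.
move=> q1; have q0 := ltnW q1.
have [n an bn] : exists2 n, (a < q ^ n)%N & (b < q ^ n)%N.
  exists (maxn a b); apply: leq_trans (ltn_expl _ q1) _;
    by rewrite leq_pexp2l ?leq_maxl ?leq_maxr.
elim: n a b an bn => [|n IHn] a b an bn ab.
  by move: an bn; rewrite expn0 !ltnS !leqn0 => /eqP-> /eqP->.
rewrite (divn_eq a q) (divn_eq b q); have := ab 0%N; rewrite expn0 !divn1 => ->.
congr (_ * _ + _)%N; apply: IHn => [||i]; rewrite ?ltn_divLR -?expnSr //.
by rewrite -!divnMA -expnS.
Qed.

Section DigitPoly.
Variables (F : finFieldType) (iota : 'I_#|F| -> F).
Hypotheses (iota_bij : bijective iota) (iota0 : iota (digit0 F) = 0).
Let q := #|F|.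
Let q1 : (1 < q)%N := finNzRing_gt1 F.
Let q0 : (0 < q)%N := ltnW q1.

Lemma digit_small (N i : nat) : (N < q ^ i)%N -> digit F N i = digit0 F.
Proof. by move=> Nq; apply: val_inj; rewrite /= divn_small // mod0n. Qed.

Lemma coef_digit_poly (N i : nat) : (digit_poly iota N)`_i = iota (digit F N i).
Proof.
rewrite coef_poly; case: ltnP => // Ni.
by rewrite digit_small ?iota0 // (leq_trans Ni) // ltnW // ltn_expl.
Qed.

(** The dictionary that turns degree conditions into comparisons of an index with a power of [q]. *)
Lemma size_digit_poly_le (N n : nat) :
  (size (digit_poly iota N) <= n)%N = (N < q ^ n)%N.
Proof.
apply/idP/idP => [le_n|Nn].
  apply: leq_trans (ltn_exp_size_digit_poly N (bij_inj iota_bij) iota0) _.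
  by rewrite leq_pexp2l.
apply/leq_sizeP => j nj; rewrite coef_digit_poly digit_small //.
by rewrite (leq_trans Nn) // leq_pexp2l.
Qed.

Lemma digit_poly_inj : injective (digit_poly iota).
Proof.
move=> a b ab; apply: (eq_from_digits q) => // i.
have : (digit_poly iota a)`_i = (digit_poly iota b)`_i by rewrite ab.
by rewrite !coef_digit_poly => /(bij_inj iota_bij) /(congr1 val).
Qed.

Lemma digit_poly_surj (f : {poly F}) : exists N, digit_poly iota N = f.
Proof.
have [iota' iotaK iota'K] := iota_bij.
elim/poly_ind: f => [|f c [N <-]].
  exists 0%N; apply/polyP => i; rewrite coef_digit_poly coef0 digit_small //.
  by rewrite expn_gt0 q0.
(* Horner's rule: [f * 'X + c] appends a lowest digit to the index of [f]. *)
exists (N * q + iota' c)%N; apply/polyP => i.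
rewrite coef_digit_poly coefD coefMX coefC.
case: i => [|i].
  rewrite !eqxx add0r -[RHS]iota'K; congr iota; apply: val_inj => /=.
  by rewrite expn0 divn1 modnMDl modn_small.
rewrite [i.+1 == 0%N]/= addr0 [i.+1.-1]/= coef_digit_poly; congr iota.
apply: val_inj => /=.
by rewrite expnS divnMA divnMDl // (divn_small (ltn_ord (iota' c))) addn0.
Qed.

(** The last property holds because [p_N = (p_N - p_a) + p_a] would have degree below [n] if both
    summands had. *)
Lemma digit_subtraction_exists : exists sigma : nat -> nat -> nat,
  (forall N a, digit_poly iota (sigma N a) = digit_poly iota N - digit_poly iota a)
  /\ degree_subtraction q sigma.
Proof.
pose Q (Na : nat * nat) b :=
  digit_poly iota b = digit_poly iota Na.1 - digit_poly iota Na.2.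
have /boolp.choice[s sE] : forall Na, exists b, Q Na b.
  by move=> Na; exact: digit_poly_surj.
exists (fun N a => s (N, a)).
have E N a : digit_poly iota (s (N, a)) = digit_poly iota N - digit_poly iota a.
  exact: (sE (N, a)).
split=> //; split=> [N a|n N a Nn an|n N a nN an].
- by apply: digit_poly_inj; rewrite !E subKr.
- move: Nn an; rewrite -!size_digit_poly_le E => Nn an.
  by rewrite (leq_trans (size_polyD _ _)) // size_polyN geq_max Nn.
- rewrite leqNgt; apply/negP; move: nN; rewrite leqNgt => /negP nN sn; apply: nN.
  move: an sn; rewrite -!size_digit_poly_le => an sn.
  rewrite -(subrK (digit_poly iota a) (digit_poly iota N)) -E.
  by rewrite (leq_trans (size_polyD _ _)) // geq_max sn.
Qed.
End DigitPoly.

(** * The thin set *)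

(** Source of the threshold 13: after cancelling [q ^ 2] the base case is
    [144 * 13 = 1872 <= 2048 = 2 ^ 11]. *)
Lemma linear_le_expn (q d : nat) : (2 <= q)%N -> (13 <= d)%N ->
  (144 * q ^ 2 * d <= q ^ d)%N.
Proof.
move=> q2 d13; rewrite -(subnK d13); move: (d - 13)%N => k.
have h : (144 * (k + 13) <= 2 ^ (k + 11))%N.
  elim: k => // k IHk; rewrite !addSn expnS.
  by move: IHk; lia.
have -> : (144 * q ^ 2 * (k + 13) = q ^ 2 * (144 * (k + 13)))%N by lia.
rewrite [in leqRHS](_ : k + 13 = 2 + (k + 11))%N; last by lia.
by rewrite expnD leq_mul2l (leq_trans h) ?orbT // leq_exp2r // addn_gt0 orbT.
Qed.

(** Both members of a pair lie below [q ^ n], so later layers leave the count for [N] unchanged. *)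
Lemma eq_pairs_below (q n N : nat) (sigma : nat -> nat -> nat) (A A' : pred nat) :
  degree_subtraction q sigma -> (N < q ^ n)%N ->
  (forall i, (i < q ^ n)%N -> A i = A' i) ->
  pairs_below sigma A (q ^ n) N = pairs_below sigma A' (q ^ n) N.
Proof.
move=> [_ sigma_lt _] Nn AA'; apply: eq_card => a; rewrite !inE.
by rewrite !AA' // sigma_lt.
Qed.

Lemma exists_thin_set (R : realType) (q : nat) (sigma : nat -> nat -> nat) :
  (2 <= q)%N -> degree_subtraction q sigma ->
  exists (A : pred nat) (C : R), 0 < C /\
    forall d N, (13 <= d)%N -> (q ^ d <= N < q ^ d.+1)%N ->
      (d%:R : R) <= (pairs_below sigma A (q ^ d.+1) N)%:R <= C * d%:R.
Proof.
move=> q2 sub_sigma; have q0 : (0 < q)%N := ltnW q2.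
(* The first term is what [next_layer] requires; the second covers the [q ^ 13] elements of the
   initial set. *)
pose M : R := 120 * q%:R ^+ 2 + q%:R ^+ 13.
have M120 : 120 * q%:R ^+ 2 <= M by rewrite lerDl exprn_ge0.
pose inv d (A : pred nat) :=
  3 / 2 * layer_scale R q d <= (count_below A (q ^ d))%:R <= M * layer_scale R q d.
pose good d (A : pred nat) := forall N, (q ^ d <= N < q ^ d.+1)%N ->
  (d%:R : R) <= (pairs_below sigma A (q ^ d.+1) N)%:R <= layer_bound q M * d%:R.
(* The invariant is a premise, so that every pair has a successor and choice yields a total [f]. *)
pose next (dA : nat * pred nat) (A' : pred nat) := inv (13 + dA.1)%N dA.2 ->
  [/\ forall n, (n < q ^ (13 + dA.1))%N -> A' n = dA.2 n,
      inv (13 + dA.1).+1 A' & good (13 + dA.1)%N A'].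
have /boolp.choice[f fnext] : forall dA, exists A', next dA A'.
  move=> [k A]; rewrite /next /=.
  have [Ainv|nAinv] := pselect (inv (13 + k)%N A); last by exists A.
  have [A' A'P] := next_layer R q (13 + k) sigma A M q2 sub_sigma (leq_addr _ _)
    (linear_le_expn _ _ q2 (leq_addr _ _)) M120 Ainv.
  by exists A'.
pose stage := fix stage (k : nat) : pred nat :=
  if k is k'.+1 then f (k', stage k') else xpredT.
have stage_inv k : inv (13 + k)%N (stage k).
  elim: k => [|k IHk]; last by rewrite addnS; have [] := fnext (k, stage k) IHk.
  (* The initial set has all [q ^ 13] indices of degree below 13. With [s^2 = 13 q^13], the lower
     bound reads [9/4 * 13 <= q^13]; the upper one follows from [s >= 1]. *)
  rewrite /inv addn0 /= count_below_predT.
  set s := layer_scale R q 13.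
  have s0 : 0 <= s := layer_scale_ge0 R q 13.
  have sE := layer_scale_sqr R q 13; rewrite -/s in sE.
  have q2R : 2 <= q%:R :> R by rewrite ler_nat.
  have Q0 : 0 <= q%:R ^+ 13 :> R by rewrite exprn_ge0.
  have Qlarge : 144 * q%:R ^+ 2 * 13 <= q%:R ^+ 13 :> R.
    by rewrite -!natrX -!natrM ler_nat linear_le_expn.
  have q4 : 4 <= q%:R ^+ 2 :> R.
    by rewrite (_ : 4 = 2 ^+ 2) ?lerXn2r ?nnegrE //; ring.
  rewrite natrX; apply/andP; split.
    rewrite -ler_sqr ?nnegrE ?mulr_ge0 // ?divr_ge0 // exprMn sE.
    rewrite [leRHS]expr2 mulrA ler_wpM2r //; lra.
  have s1 : 1 <= s.
    rewrite -[leLHS]sqrtr1 ler_wsqrtr // ler1n muln_gt0 expn_gt0 q0 //.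
  rewrite (@le_trans _ _ (M * 1)) //; first by rewrite mulr1 lerDr mulr_ge0 ?exprn_ge0.
  by rewrite ler_wpM2l // (le_trans _ M120) // mulr_ge0 ?exprn_ge0.
have stage_add k j n : (n < q ^ (13 + k))%N -> stage (k + j)%N n = stage k n.
  move=> nq; elim: j => [|j IHj]; first by rewrite addn0.
  rewrite addnS -IHj; have [+ _ _] := fnext (_, stage (k + j)%N) (stage_inv _).
  by apply; rewrite (leq_trans nq) // leq_pexp2l // leq_add2l leq_addr.
have stageE k n : (n < q ^ (13 + k))%N -> stage n n = stage k n.
  move=> nk; have nn : (n < q ^ (13 + n))%N.
    by rewrite (leq_trans (ltn_expl n q2)) // leq_pexp2l // leq_addl.
  have [kn|/ltnW nk'] := leqP k n.
    by rewrite -{1}(subnKC kn) stage_add.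
  by rewrite -(subnKC nk') stage_add.
(* The limit set is the diagonal: the stages have stabilised at [n] by stage [n], since
   [n < q ^ (13 + n)]. *)
exists (fun n => stage n n), (layer_bound q M).
split=> [|d N d13 /andP[qN Nq]].
  have M0 : 0 <= M by rewrite (le_trans _ M120) // mulr_ge0 ?exprn_ge0.
  have : 0 <= M * q%:R by rewrite mulr_ge0.
  have : 0 <= q%:R ^+ 3 :> R by rewrite exprn_ge0.
  have : 0 <= q%:R :> R by [].
  by rewrite /layer_bound; lra.
have dE : d = (13 + (d - 13))%N by rewrite subnKC.
have [_ _] := fnext (_, stage (d - 13)%N) (stage_inv (d - 13)%N).
rewrite -dE => /(_ N); rewrite qN Nq => /(_ isT).
rewrite (eq_pairs_below q _ N sigma (fun n => stage n n) (stage (d - 13).+1)) //.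
by move=> i iq; apply: stageE; rewrite addnS -dE.
Qed.

(** * Enumerating the set and counting representations *)

Lemma unbounded_enum (A : pred nat) : (forall m, exists2 n, (m <= n)%N & A n) ->
  exists2 phi : nat -> nat, {homo phi : m n / (m < n)%N} &
    forall n, A n <-> exists k, phi k = n.
Proof.
move=> unbA.
have exA m : exists n, (m <= n)%N && A n.
  by have [n mn An] := unbA m; exists n; rewrite mn.
pose next m := ex_minn (exA m).
have next_ge m : (m <= next m)%N by rewrite /next; case: ex_minnP => n /andP[].
have next_in m : A (next m) by rewrite /next; case: ex_minnP => n /andP[].
have next_le m n : (m <= n)%N -> A n -> (next m <= n)%N.
  by move=> mn An; rewrite /next; case: ex_minnP => ? _; apply; rewrite mn.
pose phi := fix phi k := if k is k'.+1 then next (phi k').+1 else next 0%N.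
have phiS k : (phi k < phi k.+1)%N by exact: next_ge.
exists phi; first by apply: homo_ltn => //; exact: ltn_trans.
move=> n; split=> [An|[[|k] <-]]; [|exact: next_in|exact: next_in].
(* By minimality of [next], no element of [A] lies strictly between consecutive values of [phi]. *)
have [K nK] : exists K, (n < phi K)%N.
  exists n.+1; elim: n {An} => [|n IHn]; first exact: leq_ltn_trans (phiS 0%N).
  exact: leq_ltn_trans (phiS _).
elim: K nK => [|k IHk] lt_n.
  by move: lt_n; rewrite ltnNge (next_le 0%N).
have [/IHk//|] := ltnP n (phi k); rewrite leq_eqVlt => /predU1P[<-|kn]; first by exists k.
by move: lt_n; rewrite ltnNge (next_le (phi k).+1).
Qed.

(** The second member of a pair is determined by the first, so [a] to [(a, sigma N a)] is a
    bijection; [n] is the degree of [p_N] plus one. *)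
Lemma repr_count_pairs_below (F : finFieldType) (iota : 'I_#|F| -> F)
    (sigma : nat -> nat -> nat) (A : pred nat) (omega : nat -> {poly F}) (n N : nat) :
  bijective iota -> iota (digit0 F) = 0 -> degree_subtraction #|F| sigma ->
  (forall N a, digit_poly iota (sigma N a) = digit_poly iota N - digit_poly iota a) ->
  (forall a, range omega (digit_poly iota a) <-> A a) ->
  size (digit_poly iota N) = n ->
  repr_count iota omega N = pairs_below sigma A (#|F| ^ n) N.
Proof.
move=> iota_bij iota0 [_ sigma_lt _] sigmaE omegaE szN.
have size_le := size_digit_poly_le _ _ iota_bij iota0.
have inj := digit_poly_inj _ _ iota_bij iota0.
rewrite /repr_count /pairs_below.
set S := [set a : _ | _]%SET.
pose f (a : 'I_(#|F| ^ n)) := (val a, sigma N a).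
have f_inj : injective f by move=> a b [/val_inj].
have -> : fset_set (repr_pairs iota omega N) = [fset f a | a in S]%fset.
  apply/fsetP => ab; rewrite in_fset_set; last first.
    exact: repr_pairs_finite (bij_inj iota_bij) iota0.
  apply/idP/imfsetP => /=.
    rewrite inE => -[[/omegaE Aa /omegaE Ab] Nab sa sb ltab].
    rewrite szN size_le in sa.
    have bE : ab.2 = sigma N ab.1 by apply: inj; rewrite sigmaE Nab addrC addKr.
    exists (Ordinal sa); rewrite /f /= -?bE; last by case: (ab).
    by rewrite inE /= -bE Aa Ab.
  move=> [a aS ->]; move: aS; rewrite finset.inE => /and3P[Aa As lta].
  rewrite inE /repr_pairs /=.
  have NN : (N < #|F| ^ n)%N by rewrite -size_le szN.
  split; rewrite ?szN ?size_le ?sigma_lt //; first by split; exact/omegaE.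
  by rewrite sigmaE subrKC.
by rewrite card_imfset //= -cardE.
Qed.

Theorem theorem3p1 (R : realType) (F : finFieldType) (iota : 'I_#|F| -> F)
    (iota_bij : bijective iota) (iota0 : iota (digit0 F) = 0) :
  exists omega : nat -> {poly F},
    is_subsequence omega (digit_poly iota) /\
    exists (C1 C2 : R) (N1 : nat),
      0 < C1 /\ 0 < C2 /\
      forall N : nat, (N1 <= N)%N ->
        C1 * ln N%:R <= (repr_count iota omega N)%:R <= C2 * ln N%:R.
Proof.
have q1 : (1 < #|F|)%N := finNzRing_gt1 F.
have [sigma [sigmaE sub_sigma]] := digit_subtraction_exists _ _ iota_bij iota0.
have [A [C [C0 AC]]] := exists_thin_set R #|F| sigma q1 sub_sigma.
have [_ sigma_lt sigma_ge] := sub_sigma.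
have size_le := size_digit_poly_le _ _ iota_bij iota0.
(* [N = q ^ d] has at least [d > 0] representations, and the larger member of any of them is at
   least [q ^ d]. *)
have unbA m : exists2 n, (m <= n)%N & A n.
  pose d := (13 + m)%N.
  have d13 : (13 <= d)%N := leq_addr _ _.
  have NN : (#|F| ^ d <= #|F| ^ d < #|F| ^ d.+1)%N by rewrite leqnn ltn_exp2l // ltnSn.
  have /andP[+ _] := AC d (#|F| ^ d)%N d13 NN.
  rewrite ler_nat => d_le.
  have /card_gt0P[a] := leq_trans (leq_ltn_trans (leq0n 12) d13) d_le.
  rewrite finset.inE => /and3P[_ As lta]; exists (sigma (#|F| ^ d)%N a) => //.
  apply: (@leq_trans (#|F| ^ d)%N).
    by rewrite (leq_trans _ (ltnW (ltn_expl _ q1))) // leq_addl.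
  rewrite leqNgt; apply/negP => s_lt.
  have := sigma_ge d _ _ (leqnn (#|F| ^ d)%N) (ltn_trans lta s_lt).
  by rewrite leqNgt s_lt.
have [phi phi_homo phiE] := unbounded_enum A unbA.
pose omega k := digit_poly iota (phi k).
have omegaE a : range omega (digit_poly iota a) <-> A a.
  rewrite phiE; split=> [[k _ /(digit_poly_inj _ _ iota_bij iota0) <-]|[k <-]].
    by exists k.
  by exists k.
exists omega; split; first by exists phi.
have lnq : 0 < ln (#|F|%:R : R) by rewrite ln_gt0 // ltr1n.
(* If [p_N] has degree [d], then [d ln q <= ln N <= (d + 1) ln q <= 2 d ln q], which turns bounds in
   [d] into bounds in [ln N]. *)
exists ((ln (#|F|%:R : R))^-1 / 2), (C / ln (#|F|%:R : R)), (#|F| ^ 13)%N.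
rewrite divr_gt0 ?invr_gt0 // divr_gt0 //; split=> //; split=> // N N1.
have N0 : (0 < N)%N by rewrite (leq_trans _ N1) // expn_gt0 ltnW.
pose d := trunc_log #|F| N.
have /andP[dN Nd] := trunc_log_bounds q1 N0; rewrite -/d in dN Nd.
have d13 : (13 <= d)%N by rewrite /d trunc_log_max.
have szN : size (digit_poly iota N) = d.+1.
  by apply/eqP; rewrite eqn_leq size_le Nd ltnNge size_le -leqNgt.
rewrite (repr_count_pairs_below _ _ sigma A _ d.+1) //.
have /andP[lo hi] : (d%:R : R) <= (pairs_below sigma A (#|F| ^ d.+1) N)%:R <= C * d%:R.
  by apply: AC => //; rewrite dN.
have lnN_lo : d%:R * ln #|F|%:R <= ln N%:R :> R.
  rewrite mulr_natl -lnXn ?ltr0n ?(ltnW q1) //.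
  rewrite ler_ln ?posrE ?exprn_gt0 ?ltr0n ?(ltnW q1) //.
  by rewrite -natrX ler_nat.
have lnN_hi : ln N%:R <= d.+1%:R * ln #|F|%:R :> R.
  rewrite mulr_natl -lnXn ?ltr0n ?(ltnW q1) //.
  rewrite ler_ln ?posrE ?exprn_gt0 ?ltr0n ?(ltnW q1) //.
  by rewrite -natrX ler_nat ltnW.
have d1 : 1 <= d%:R :> R by rewrite ler1n (leq_trans _ d13).
apply/andP; split.
  apply: le_trans lo.
  have : (ln #|F|%:R)^-1 * ln N%:R <= d%:R + 1 :> R.
    by rewrite mulrC ler_pdivrMr // natr1.
  by rewrite mulrAC; lra.
apply: le_trans hi _; rewrite -mulrA ler_wpM2l ?(ltW C0) //.
by rewrite [leRHS]mulrC ler_pdivlMr.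
Qed.
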